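(* Let $f: C\to B$, $h: A\to B$, $g: P\to A$ and $j: P\to C$ be ls-continuous maps between ls-spaces such that the square with $fj\sim hg$ represents a pullback in the coarse category (so $g$ is the pullback of $f$ along $h$). If $f$ is coarsely monotone, then $g$ is also coarsely monotone.
   Context: For families $\mathcal{B},\mathcal{U}$ of subsets of a set $X$, $\mathrm{st}(B,\mathcal{U})$ is the union of the elements of $\mathcal{U}$ that intersect $B\subseteq X$, and $\mathrm{st}(\mathcal{B},\mathcal{U})=\{\mathrm{st}(B,\mathcal{U})\mid B\in\mathcal{B}\}$. A large scale structure (ls-structure) on $X$ is a nonempty set $\mathcal{L}$ of families of subsets of $X$ (the uniformly bounded families) such that (1) if $\mathcal{B}_1\in\mathcal{L}$ and each element of $\mathcal{B}_2$ with more than one point is contained in an element of $\mathcal{B}_1$, then $\mathcal{B}_2\in\mathcal{L}$; (2) $\mathcal{B}_1,\mathcal{B}_2\in\mathcal{L}$ implies $\mathrm{st}(\mathcal{B}_1,\mathcal{B}_2)\in\mathcal{L}$. An ls-space is a set with an ls-structure. A map $f:X\to Y$ of ls-spaces is ls-continuous if $f(\mathcal{U})=\{f(U)\mid U\in\mathcal{U}\}$ is uniformly bounded for every uniformly bounded $\mathcal{U}$. Maps $f,g:X\to Y$ are close ($f\sim g$) if $\{\{f(x),g(x)\}\mid x\in X\}$ is uniformly bounded. An ls-continuous map is a coarse equivalence if it has an ls-continuous inverse up to closeness. The coarse category has ls-spaces as objects and closeness classes of ls-continuous maps as morphisms. Explicitly, the square is a pullback in the coarse category if $fj\sim hg$ and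 for any ls-space $X$ and ls-continuous $u:X\to A$, $v:X\to C$ with $hu\sim fv$ there is an ls-continuous $w:X\to P$, unique up to closeness, with $gw\sim u$ and $jw\sim v$. For a family $\mathcal{U}$ of subsets of $X$ and $S\subseteq X$, the $\mathcal{U}$-components of $S$ are the equivalence classes of the relation on $S$: $x,x'$ are joined by a finite sequence $x=x_1,\dots,x_k=x'$ in $S$ such that each pair $x_i,x_{i+1}$ lies in a common element of $\mathcal{U}$. For ls-continuous $f:X\to Y$ and uniformly bounded $\mathcal{U}$ in $X$, $\mathcal{V}$ in $Y$, $c(\mathcal{U},f,\mathcal{V})$ is the family of all $\mathcal{U}$-components of sets $f^{-1}(V)$, $V\in\mathcal{V}$. The light structure on $X$ with respect to $f$ is the closure under refinement of the set of all $c(\mathcal{U},f,\mathcal{V})$ (all families each of whose elements with more than one point is contained in an element of one fixed $c(\mathcal{U},f,\mathcal{V})$); it is an ls-structure. $X_f$ denotes the set $X$ with this structure. The map $f$ is coarsely monotone if $f$, regarded as a map $X_f\to Y$, is a coarse equivalence. *)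

(* Defs.v *)
#[warnings="-notation-overridden"]
From mathcomp Require Import all_boot boolp classical_sets.
From mathcomp Require Import zify.

Set Implicit Arguments.
Unset Strict Implicit.
Unset Printing Implicit Defensive.

Local Open Scope classical_set_scope.

Section Families.
Variable X : Type.
Implicit Types (B S D : set X) (BB UU : set (set X)).

Definition star B UU : set X :=
  \bigcup_(U in [set U | UU U /\ U `&` B !=set0]) U.

Definition star_family BB UU : set (set X) := [set star B UU | B in BB].

Definition many_points B := exists x y, [/\ B x, B y & x <> y].

Definition refines BB UU :=
  forall B, BB B -> many_points B -> exists2 U, UU U & B `<=` U.

(* The sequence is s 0, ..., s n, so that n = 0 joins each point of S to
   itself, even when no element of UU contains it. *)
Definition joined UU S (x x' : X) :=
  exists (n : nat) (s : nat -> X),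
    [/\ s 0%N = x, s n = x', (forall i, (i <= n)%N -> S (s i)) &
        forall i, (i < n)%N -> exists2 U, UU U & U (s i) /\ U (s i.+1)].

Definition components UU S : set (set X) :=
  [set [set x' | joined UU S x x'] | x in S].

End Families.

Record ls_structure (X : Type) := LsStructure {
  bounded_families : set (set (set X));
  ls_nonempty : bounded_families !=set0;
  ls_refines : forall B1 B2 : set (set X),
    bounded_families B1 -> refines B2 B1 -> bounded_families B2;
  ls_star : forall B1 B2 : set (set X),
    bounded_families B1 -> bounded_families B2 ->
    bounded_families (star_family B1 B2) }.

Record lsSpace := LsSpace {
  ls_carrier :> Type;
  ls_struct : ls_structure ls_carrier }.

Definition unif_bounded (X : lsSpace) (UU : set (set X)) : Prop :=
  bounded_families (ls_struct X) UU.

Definition ls_continuous (X Y : lsSpace) (f : X -> Y) :=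
  forall UU : set (set X), unif_bounded UU ->
    unif_bounded [set f @` U | U in UU].

Definition close (X : Type) (Y : lsSpace) (f g : X -> Y) :=
  unif_bounded [set [set f x; g x] | x in [set: X]].

Definition coarse_equivalence (X Y : lsSpace) (f : X -> Y) :=
  ls_continuous f /\
  exists k : Y -> X,
    [/\ ls_continuous k, close (k \o f) id & close (f \o k) id].

Definition coarse_pullback (A B C P : lsSpace)
    (f : C -> B) (h : A -> B) (g : P -> A) (j : P -> C) :=
  close (f \o j) (h \o g) /\
  forall (X : lsSpace) (u : X -> A) (v : X -> C),
    ls_continuous u -> ls_continuous v -> close (h \o u) (f \o v) ->
    exists w : X -> P,
      [/\ ls_continuous w, close (g \o w) u, close (j \o w) v &
        forall w' : X -> P, ls_continuous w' ->
          close (g \o w') u -> close (j \o w') v -> close w' w].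

Section Joined.
Variable X : Type.
Implicit Types (S T : set X) (UU VV : set (set X)).

Lemma joined_refl UU S x : S x -> joined UU S x x.
Proof. by move=> Sx; exists 0%N, (fun=> x); split. Qed.

Lemma joined_in UU S x y : joined UU S x y -> S x /\ S y.
Proof. by move=> [n [s [<- <- Ss _]]]; split; exact: Ss. Qed.

Lemma joined_sym UU S x y : joined UU S x y -> joined UU S y x.
Proof.
move=> [n [s [s0 sn Ss sU]]]; exists n, (fun i => s (n - i)%N); split.
- by rewrite subn0.
- by rewrite subnn.
- by move=> i _; apply: Ss; lia.
- move=> i ltin; have [|U UUU [Ui Ui1]] := sU (n - i.+1)%N; first by lia.
  by exists U => //; split=> //; have -> : (n - i)%N = (n - i.+1).+1 by lia.
Qed.

Lemma joined_trans UU S x y z :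
  joined UU S x y -> joined UU S y z -> joined UU S x z.
Proof.
move=> [n [s [s0 sn Ss sU]]] [m [t [t0 tm St tU]]].
exists (n + m)%N, (fun i => if (i <= n)%N then s i else t (i - n)%N); split.
- by rewrite leq0n.
- case: leqP => h; last by rewrite addKn.
  have m0 : m = 0%N by lia.
  by rewrite m0 addn0 sn -t0 -m0.
- by move=> i ile; case: leqP => h; [exact: Ss | apply: St; lia].
- move=> i ilt; case: (ltngtP i n) => h.
  + exact: sU.
  + have [|U UUU [Ui Ui1]] := tU (i - n)%N; first by lia.
    by exists U => //; have -> : (i.+1 - n)%N = (i - n).+1 by lia.
  + have [|U UUU [Ui Ui1]] := tU 0%N; first by lia.
    exists U => //; split; first by rewrite h sn -t0.
    by have -> : (i.+1 - n)%N = 1%N by lia.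
Qed.

Lemma joined_sub UU VV S T x y :
  (forall U a b, UU U -> U a -> U b -> exists2 V, VV V & V a /\ V b) ->
  S `<=` T -> joined UU S x y -> joined VV T x y.
Proof.
move=> UV ST [n [s [s0 sn Ss sU]]]; exists n, s; split=> //.
  by move=> i ilt; exact/ST/Ss.
by move=> i ilt; have [U UUU [Ui Ui1]] := sU i ilt; exact: (UV U).
Qed.

Definition add_points UU : set (set X) := UU `|` range (@set1 X).

Lemma bounded_add_points (L : ls_structure X) UU :
  bounded_families L UU -> bounded_families L (add_points UU).
Proof.
move=> LU; apply: (ls_refines LU) => D [UD _|[x _ <-] [y [z [-> -> //]]]].
by exists D.
Qed.

Lemma sub_star_add_points UU S : S `<=` star S (add_points UU).
Proof. by move=> x Sx; exists [set x] => //; split; [right; exists x|exists x]. Qed.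

End Joined.

Section Light.
Variables (X Y : lsSpace) (f : X -> Y).

Definition light_components (UU : set (set X)) (VV : set (set Y)) :
    set (set X) :=
  \bigcup_(V in VV) components UU (f @^-1` V).

Definition light_families : set (set (set X)) :=
  [set BB | exists UU VV, [/\ unif_bounded UU, unif_bounded VV &
    refines BB (light_components UU VV)]].

Lemma light_nonempty : light_families !=set0.
Proof.
have [UU LU] := ls_nonempty (ls_struct X).
have [VV LV] := ls_nonempty (ls_struct Y).
by exists (light_components UU VV), UU, VV; split=> // B BB _; exists B.
Qed.

Lemma light_refines (B1 B2 : set (set X)) :
  light_families B1 -> refines B2 B1 -> light_families B2.
Proof.
move=> [UU [VV [LU LV r1]]] r2; exists UU, VV; split=> // D B2D mD.
have [E B1E DE] := r2 D B2D mD.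
have [|F cF EF] := r1 E B1E; last by exists F => //; exact: subset_trans EF.
by have [x [y [Dx Dy xy]]] := mD; exists x, y; split=> //; exact: DE.
Qed.

Let joined_light UU VV (BB : set (set X)) D x :
  refines BB (light_components UU VV) -> BB D -> D x ->
  exists2 V, add_points VV V & V (f x) /\
    forall y, D y -> joined UU (f @^-1` V) x y.
Proof.
move=> rB BD Dx; have [mD|nD] := pselect (many_points D).
  have [_ [V VVV [z Vz <-]] DE] := rB D BD mD; exists V; first by left.
  have zx : joined UU (f @^-1` V) z x := DE x Dx.
  split; first by have [] := joined_in zx.
  by move=> y /DE zy; apply: joined_trans zy; exact: joined_sym.
exists [set f x]; first by right; exists (f x).
split=> // y Dy; have [<-|xy] := pselect (x = y); first exact: joined_refl.
by case: nD; exists x, y.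
Qed.

Lemma light_star (B1 B2 : set (set X)) :
  light_families B1 -> light_families B2 -> light_families (star_family B1 B2).
Proof.
move=> [U1 [V1 [LU1 LV1 r1]]] [U2 [V2 [LU2 LV2 r2]]].
pose WW := star_family (add_points U1) (add_points U2).
exists WW, (star_family (add_points V1) (add_points V2)); split.
- by apply: ls_star; exact: bounded_add_points.
- by apply: ls_star; exact: bounded_add_points.
have U1W U a b : U1 U -> U a -> U b -> exists2 W, WW W & W a /\ W b.
  move=> UU Ua Ub; exists (star U (add_points U2)); first by exists U => //; left.
  by split; exact: sub_star_add_points.
have U2W U a b : U2 U -> U a -> U b -> exists2 W, WW W & W a /\ W b.
  move=> UU Ua Ub; exists (star [set a] (add_points U2)).
    by exists [set a] => //; right; exists a.
  by split; exists U => //; (split; [left|exists a]).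
move=> _ [D B1D <-] [p [_ [[E [B2E [x [_ Dx]]] _] _ _]]].
have [V V1V [Vx Dj]] := joined_light r1 B1D Dx.
pose T := star V (add_points V2).
exists [set y | joined WW (f @^-1` T) x y].
  exists T; first by exists V.
  by exists x => //; exact: sub_star_add_points.
move=> y [F [B2F [z [Fz Dz]]] Fy] /=.
have xz := Dj z Dz; have [_ /= Vz] := joined_in xz.
have [V' V2V' [V'z Fj]] := joined_light r2 B2F Fz.
apply: (@joined_trans _ _ _ _ z).
  by apply: joined_sub xz; [exact: U1W | exact: preimage_subset (@sub_star_add_points _ _ _)].
apply: joined_sub (Fj y Fy); [exact: U2W | move=> w V'w].
by exists V' => //; split=> //; exists (f z).
Qed.

Definition light_structure : ls_structure X :=
  LsStructure light_nonempty light_refines light_star.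

Definition light_space : lsSpace := LsSpace light_structure.

Definition coarsely_monotone :=
  @coarse_equivalence light_space Y f.

End Light.

(* Main.v *)
(** Testing the pullback on sets with the discrete ls-structure, where every
    map is ls-continuous, shows that maps into [P] may be built and compared up
    to closeness through their composites with [g] and [j], with no continuity
    required. Hence if [x, y : T -> P] have [g x ~ g y] in [A] and [j x ~ j y]
    in [C_f], then [x ~ y] in [P_g]: the chains in [C] joining [j (x t)] to
    [j (y t)] lift to chains in [P] lying over a neighbourhood of [g (x t)].
    An inverse [k : B -> C_f] of [f] yields [m : A -> P] with [g m ~ id] and
    [j m ~ k h]; the previous sentence shows that [m] is ls-continuous into
    [P_g] and that [m g ~ id] in [P_g]. *)

#[warnings="-notation-overridden"]
From mathcomp Require Import all_boot boolp classical_sets.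
Require Import Defs.

Set Implicit Arguments.
Unset Strict Implicit.
Unset Printing Implicit Defensive.

Local Open Scope classical_set_scope.

(** * Closeness, ls-continuity and the light structure *)

Lemma bounded_singletons (X : lsSpace) : @unif_bounded X (range (@set1 X)).
Proof.
have [UU LU] := ls_nonempty (ls_struct X).
by apply: (ls_refines LU) => _ [x _ <-] [a [b [-> ->]]].
Qed.

(** This form allows any uniformly bounded witness, so families can be enlarged by stars instead of
    being kept as families of pairs. *)
Lemma closeP (T : Type) (Y : lsSpace) (x y : T -> Y) :
  close x y <-> exists2 UU : set (set Y), unif_bounded UU &
    forall t, exists2 U, UU U & U (x t) /\ U (y t).
Proof.
split=> [xy|[UU LU xyU]].
  exists [set [set x t; y t] | t in [set: T]] => // t.
  by exists [set x t; y t]; [exists t | split; [left|right]].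
apply: (ls_refines LU) => _ [t _ <-] _.
by have [U UUU [Ux Uy]] := xyU t; exists U => // z [->|->].
Qed.

Lemma close_refl (T : Type) (Y : lsSpace) (x : T -> Y) : close x x.
Proof.
apply/closeP; exists (range (@set1 Y)); first exact: bounded_singletons.
by move=> t; exists [set x t] => //; exists (x t).
Qed.

Lemma close_sym (T : Type) (Y : lsSpace) (x y : T -> Y) :
  close x y -> close y x.
Proof.
move=> /closeP[UU LU xyU]; apply/closeP; exists UU => // t.
by have [U UUU [Ux Uy]] := xyU t; exists U.
Qed.

Lemma close_trans (T : Type) (Y : lsSpace) (x y z : T -> Y) :
  close x y -> close y z -> close x z.
Proof.
move=> /closeP[UU LU xyU] /closeP[VV LV yzV]; apply/closeP.
exists (star_family UU (add_points VV)).
  by apply: ls_star => //; exact: bounded_add_points.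
move=> t; have [U UUU [Ux Uy]] := xyU t; have [V VVV [Vy Vz]] := yzV t.
exists (star U (add_points VV)); first by exists U.
split; first exact: sub_star_add_points.
by exists V => //; split; [left | exists (y t)].
Qed.

Lemma close_pre (S T : Type) (Y : lsSpace) (e : S -> T) (x y : T -> Y) :
  close x y -> close (x \o e) (y \o e).
Proof.
move=> /closeP[UU LU xyU]; apply/closeP; exists UU => // s.
exact: xyU (e s).
Qed.

(** For the converse, one tests on the two projections from the type of all pairs lying in a common
    element of [UU]. *)
Lemma ls_continuousP (X Y : lsSpace) (f : X -> Y) :
  ls_continuous f <->
  forall (T : Type) (x y : T -> X), close x y -> close (f \o x) (f \o y).
Proof.
split=> [cf T x y /closeP[UU LU xyU]|cf UU LU].
  apply/closeP; exists [set f @` U | U in UU]; first exact: cf.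
  move=> t; have [U UUU [Ux Uy]] := xyU t; exists (f @` U); first by exists U.
  by split; [exists (x t) | exists (y t)].
pose T := {p : X * X | exists2 U, UU U & U p.1 /\ U p.2}.
have /cf/closeP[DD LD fD] :
    close (fun t : T => (sval t).1) (fun t : T => (sval t).2).
  by apply/closeP; exists UU => // -[].
apply: (ls_refines (ls_star (bounded_singletons Y) LD)).
move=> _ [U UUU <-] [_ [_ [[a Ua <-] _ _]]].
exists (star [set f a] DD); first by exists [set f a] => //; exists (f a).
move=> _ [b Ub <-].
have abT : exists2 U, UU U & U (a, b).1 /\ U (a, b).2 by exists U.
have [D DDD [/= Da Db]] := fD (exist _ (a, b) abT).
by exists D => //; split=> //; exists (f a).
Qed.

Lemma close_lightP (X Y : lsSpace) (f : X -> Y) (T : Type) (x y : T -> X) :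
  @close T (light_space f) x y <->
  exists (UU : set (set X)) (VV : set (set Y)),
    [/\ unif_bounded UU, unif_bounded VV &
      forall t, exists2 V, VV V & joined UU (f @^-1` V) (x t) (y t)].
Proof.
split=> [/closeP[BB [UU [VV [LU LV rB]]] xyB]|[UU [VV [LU LV xyV]]]].
  exists UU, (add_points VV); split=> //; first exact: bounded_add_points.
  move=> t; have [D BD [Dx Dy]] := xyB t.
  (* [refines] does not constrain elements with at most one point, so equal values get the singleton
     supplied by [add_points]. *)
  have [xy|xy] := pselect (x t = y t).
    exists [set f (x t)]; first by right; exists (f (x t)).
    by rewrite -xy; exact: joined_refl.
  have [|_ [V VVV [z Vz <-]] DE] := rB D BD; first by exists (x t), (y t).
  exists V; first by left.
  by apply: (joined_trans (y := z)); [apply: joined_sym|]; exact: DE.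
apply/closeP; exists (light_components f UU VV).
  by exists UU, VV; split=> // B BB _; exists B.
move=> t; have [V VVV xy] := xyV t; have [Vx _] := joined_in xy.
exists [set z | joined UU (f @^-1` V) (x t) z]; first by exists V => //; exists (x t).
by split=> //; exact: joined_refl.
Qed.

Lemma joined_step (X : Type) (UU : set (set X)) (S U : set X) (a b : X) :
  UU U -> U a -> U b -> S a -> S b -> joined UU S a b.
Proof.
move=> UUU Ua Ub Sa Sb; exists 1%N, (fun i => if i is 0%N then a else b).
by split=> // -[|i] // _; exists U.
Qed.

Lemma close_light (X Y : lsSpace) (f : X -> Y) (T : Type) (x y : T -> X) :
  ls_continuous f -> close x y -> @close T (light_space f) x y.
Proof.
move=> cf /closeP[UU LU xyU]; apply/close_lightP.
exists UU, [set f @` U | U in UU]; split=> //; first exact: cf.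
move=> t; have [U UUU [Ux Uy]] := xyU t; exists (f @` U); first by exists U.
by apply: (joined_step UUU) => //; [exists (x t) | exists (y t)].
Qed.

Lemma ls_continuous_light (X Y : lsSpace) (f : X -> Y) :
  @ls_continuous (light_space f) Y f.
Proof.
apply/ls_continuousP => T x y /close_lightP[UU [VV [_ LV xyV]]].
apply/closeP; exists VV => // t.
by have [V VVV xy] := xyV t; have [] := joined_in xy; exists V.
Qed.

(** * The discrete ls-structure *)

Section Discrete.
Variable T : Type.

Definition discrete_families : set (set (set T)) :=
  [set BB | forall B, BB B -> ~ many_points B].

Lemma discrete_nonempty : discrete_families !=set0.
Proof. by exists set0. Qed.

Lemma discrete_refines (B1 B2 : set (set T)) :
  discrete_families B1 -> refines B2 B1 -> discrete_families B2.
Proof.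
move=> d1 r2 B BB mB; have [U B1U BU] := r2 B BB mB.
by have [x [y [Bx By xy]]] := mB; apply: (d1 U) => //; exists x, y; split=> //; exact: BU.
Qed.

Lemma discrete_star (B1 B2 : set (set T)) :
  discrete_families B1 -> discrete_families B2 ->
  discrete_families (star_family B1 B2).
Proof.
move=> d1 d2 _ [B BB <-] [x [y [[U [UU [a [Ua Ba]]] Ux] [V [VV [b [Vb Bb]]] Vy] xy]]].
have point D D' p q : discrete_families D -> D D' -> D' p -> D' q -> p = q.
  by move=> dD DD' pD qD; apply: contrapT => pq; apply: (dD D') => //; exists p, q.
apply: xy; rewrite (point _ _ _ _ d2 UU Ux Ua) (point _ _ _ _ d2 VV Vy Vb).
exact: (point _ _ _ _ d1 BB).
Qed.

Definition discrete_space : lsSpace :=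
  LsSpace (LsStructure discrete_nonempty discrete_refines discrete_star).

Lemma ls_continuous_discrete (Y : lsSpace) (x : discrete_space -> Y) :
  ls_continuous x.
Proof.
move=> UU dU; apply: (ls_refines (bounded_singletons Y)).
move=> _ [U UUU <-] [_ [_ [[a Ua <-] [b Ub <-] xab]]].
by case: (dU U UUU); exists a, b; split=> // ab; apply: xab; rewrite ab.
Qed.

End Discrete.

(** * Lifting and comparing maps into the pullback *)

Section Pullback.
Variables (A B C P : lsSpace).
Variables (f : C -> B) (h : A -> B) (g : P -> A) (j : P -> C).
Hypothesis g_ls : ls_continuous g.
Hypothesis pb : coarse_pullback f h g j.

Lemma pullback_lift (T : Type) (u : T -> A) (v : T -> C) :
  close (h \o u) (f \o v) ->
  exists2 w : T -> P, close (g \o w) u & close (j \o w) v.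
Proof.
move=> uv.
have [//|//|//|w [_ gw jw _]] := pb.2 (discrete_space T) u v.
- exact: ls_continuous_discrete.
- exact: ls_continuous_discrete.
- by exists w.
Qed.

(** Both maps solve the lifting problem for [g \o x] and [j \o x], so both are close to its solution
    [w]. *)
Lemma pullback_close (T : Type) (x y : T -> P) :
  close (g \o x) (g \o y) -> close (j \o x) (j \o y) -> close x y.
Proof.
move=> gxy jxy.
have [||//|w [_ _ _ uniq_w]] := pb.2 (discrete_space T) (g \o x) (j \o x).
- exact: ls_continuous_discrete.
- exact: ls_continuous_discrete.
- exact/close_sym/(close_pre x pb.1).
have dc := @ls_continuous_discrete T P.
apply: close_trans (close_sym (uniq_w y (dc y) (close_sym gxy) (close_sym jxy))).
by apply: (uniq_w x) => //; exact: close_refl.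
Qed.

(** One map [w] on [T * C] lifts the points of all chains at once: [w (t, c)] has [g]-image near
    [g (x t)] and, when [over (t, c)] holds, [j]-image near [c]. A single lift makes all bounds
    uniform in [t] and along the chains. *)
Lemma pullback_close_light (T : Type) (x y : T -> P) :
  close (g \o x) (g \o y) -> @close T (light_space f) (j \o x) (j \o y) ->
  @close T (light_space g) x y.
Proof.
move=> gxy /close_lightP[UU [VV [LU LV xyV]]].
pose over (z : T * C) := exists2 V, VV V & V (f (j (x z.1))) /\ V (f z.2).
(* Off [over] the second component is reset to [j (x t)], so that lifting
   [(g (x t), v (t, c))] is possible for all [(t, c)]. *)
pose v z := if pselect (over z) then z.2 else j (x z.1).
have v_over z : over z -> v z = z.2 by rewrite /v; case: pselect.
have [|w gw jw] := @pullback_lift (T * C) (fun z => g (x z.1)) v.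
  apply: close_trans (_ : close (f \o (fun z => j (x z.1))) _).
    exact/close_sym/(close_pre (fun z : T * C => x z.1) pb.1).
  apply/closeP; exists (add_points VV); first exact: bounded_add_points.
  move=> z; have [oz|noz] := pselect (over z).
    by rewrite /= v_over //; have [V VVV ?] := oz; exists V => //; left.
  exists [set f (j (x z.1))]; first by right; exists (f (j (x z.1))).
  by rewrite /v /=; case: pselect.
have over_x t : over (t, j (x t)).
  by have [V VVV xy] := xyV t; have [] := joined_in xy; exists V.
have over_y t : over (t, j (y t)).
  by have [V VVV xy] := xyV t; have [] := joined_in xy; exists V.
(* The lifted chains end near [x t] and [y t], not at them; [x_w] and [y_w] absorb the
   difference. *)
have x_w : close x (fun t => w (t, j (x t))).
  apply: pullback_close; first exact/close_sym/(close_pre (fun t => (t, j (x t))) gw).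
  have := close_sym (close_pre (fun t => (t, j (x t))) jw).
  by congr (close _ _); apply/funext => t /=; rewrite v_over.
have y_w : close y (fun t => w (t, j (y t))).
  apply: pullback_close.
    apply: close_trans (close_sym gxy) _.
    exact/close_sym/(close_pre (fun t => (t, j (y t))) gw).
  have := close_sym (close_pre (fun t => (t, j (y t))) jw).
  by congr (close _ _); apply/funext => t /=; rewrite v_over.
apply: close_trans (close_light g_ls x_w) _.
apply: close_trans _ (close_sym (close_light g_ls y_w)).
(* Indexing by all possible chain steps yields one family [DD] that contains every lifted step. *)
pose step (z : T * (C * C)) :=
  [/\ over (z.1, z.2.1), over (z.1, z.2.2) &
      exists2 U, UU U & U z.2.1 /\ U z.2.2].
pose e1 (s : {z | step z}) := ((sval s).1, (sval s).2.1).
pose e2 (s : {z | step z}) := ((sval s).1, (sval s).2.2).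
have /closeP[DD LD wD] : close (w \o e1) (w \o e2).
  apply: pullback_close.
    exact: close_trans (close_pre e1 gw) (close_sym (close_pre e2 gw)).
  apply: close_trans (close_pre e1 jw) _.
  apply: close_trans _ (close_sym (close_pre e2 jw)).
  apply/closeP; exists UU => // -[z oz]; have [o1 o2 UUz] := oz.
  by rewrite /= !v_over.
(* Each [g (w (t, c))] shares an element of [WW] with [g (x t)], so the star of [g (x t)] contains
   the [g]-image of the whole lifted chain. *)
have [WW LW gwW] := (closeP _ _).1 gw.
apply/close_lightP; exists DD, (star_family (range (@set1 A)) WW); split=> //.
  by apply: ls_star => //; exact: bounded_singletons.
move=> t; exists (star [set g (x t)] WW).
  by exists [set g (x t)] => //; exists (g (x t)).
have [V VVV xy] := xyV t.
have Vx : V (f (j (x t))) by have [] := joined_in xy.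
have [n [s [s0 sn sV sU]]] := xy.
exists n, (fun i => w (t, s i)); split.
- by rewrite s0.
- by rewrite sn.
- move=> i _ /=; have [W WWW [Ww Wx]] := gwW (t, s i).
  by exists W => //; split=> //; exists (g (x t)).
- move=> i lt_in.
  have st : step (t, (s i, s i.+1)).
    split; last exact: sU.
    + by exists V => //; split=> //; apply: sV; exact: ltnW.
    + by exists V => //; split=> //; exact: sV.
  exact: wD (exist _ _ st).
Qed.

End Pullback.

Theorem proposition7p1 (A B C P : lsSpace)
    (f : C -> B) (h : A -> B) (g : P -> A) (j : P -> C)
    (f_ls : ls_continuous f) (h_ls : ls_continuous h)
    (g_ls : ls_continuous g) (j_ls : ls_continuous j)
    (pb : coarse_pullback f h g j)
    (f_mono : coarsely_monotone f) :
  coarsely_monotone g.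
Proof.
split; first exact: ls_continuous_light.
have [_ [k [k_ls kf fk]]] := f_mono.
have /ls_continuousP kC := k_ls; have /ls_continuousP hC := h_ls.
have [|m gm jm] := pullback_lift pb (u := id) (v := k \o h).
  exact/close_sym/(close_pre h fk).
have jm_light := close_light f_ls jm.
exists m; split=> //.
  (* In [A], [g m a ~ a ~ b ~ g m b]; in the light space of [f], [j m a ~ k h a ~ k h b ~ j m b]. *)
  apply/ls_continuousP => T a b ab; apply: (pullback_close_light g_ls pb).
    apply: close_trans (close_pre a gm) _.
    exact: close_trans ab (close_sym (close_pre b gm)).
  apply: close_trans (close_pre a jm_light) _.
  exact: close_trans (kC _ _ _ (hC _ _ _ ab)) (close_sym (close_pre b jm_light)).
(* In the light space of [f], [j m g ~ k h g ~ k f j ~ j]. *)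
apply: (pullback_close_light g_ls pb); first exact (close_pre g gm).
apply: close_trans (close_pre g jm_light) _.
exact: close_trans (kC _ _ _ (close_sym pb.1)) (close_pre j kf).
Qed.
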